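(* Let $X_1,X_2,\ldots$ be i.i.d. random variables with $\mathbb EX_k=0$, $\operatorname{Var}X_k=1$, such that for some $\alpha\in[1,2)$ and $D>0$, $$\lim_{x\to+\infty}\frac1{x^\alpha}\log\mathbb P[X_1>x]=-D.$$ Then $\lim_{n\to\infty}\mathbb P[\mathbf M_n=\mathbf U_n]=1$, where $\mathbf U_n=\max\{X_1,\ldots,X_n\}$.
   Context: $S_0=0$, $S_k=X_1+\cdots+X_k$, $\mathbf M_n=\max_{0\leq i<j\leq n}\frac{S_j-S_i}{\sqrt{j-i}}$. *)

(* Defs.v *)
From HB Require Import structures.
From mathcomp Require Import all_boot all_order all_algebra.
From mathcomp Require Import all_classical all_reals all_analysis.
Set Implicit Arguments. Unset Strict Implicit. Unset Printing Implicit Defensive.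
Import Order.TTheory GRing.Theory Num.Theory.
Import numFieldNormedType.Exports.
Local Open Scope classical_set_scope.
Local Open Scope ring_scope.

Section defs.
Context d (T : measurableType d) (R : realType) (P : probability T R).

Definition mutually_independent (X : nat -> T -> R) : Prop :=
  forall (I : seq nat) (B : nat -> set R), uniq I ->
    (forall i, i \in I -> measurable (B i)) ->
    P (\big[setI/setT]_(i <- I) (X i @^-1` B i)) =
    (\prod_(i <- I) P (X i @^-1` B i))%E.

Definition identically_distributed (X : nat -> T -> R) : Prop :=
  forall (k : nat) (B : set R), measurable B ->
    P (X k @^-1` B) = P (X 0 @^-1` B).

End defs.

(* Convention: X k (k : nat) stands for X_{k+1} of the paper. *)
Definition Ssum {T : Type} {R : realType} (X : nat -> T -> R) (k : nat) (w : T) : R :=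
  \sum_(i < k) X i w.

(* M_n = max_{0 <= i < j <= n} (S_j - S_i) / sqrt (j - i), valued in \bar R
   (equals -oo for n = 0, where the max is empty). *)
Definition Mmax {T : Type} {R : realType} (X : nat -> T -> R) (n : nat) (w : T) : \bar R :=
  \big[maxe/-oo%E]_(j < n.+1) \big[maxe/-oo%E]_(i < j)
     ((Ssum X j w - Ssum X i w) / Num.sqrt ((j - i)%:R))%:E.

Definition Umax {T : Type} {R : realType} (X : nat -> T -> R) (n : nat) (w : T) : \bar R :=
  \big[maxe/-oo%E]_(k < n) (X k w)%:E.

(* Main.v *)
Require Import Defs.
From HB Require Import structures.
From mathcomp Require Import all_boot all_order all_algebra.
From mathcomp Require Import all_classical all_reals all_analysis.
From mathcomp Require Import measurable_realfun ring lra.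
Import Order.TTheory GRing.Theory Num.Theory.
Import numFieldNormedType.Exports.
Import HBNNSimple.
Local Open Scope classical_set_scope.
Local Open Scope ring_scope.
Set Implicit Arguments.
Unset Strict Implicit.
Unset Printing Implicit Defensive.

(**
Blocks of length 1 give M_n >= U_n, so M_n = U_n as soon as, for some level u,
U_n > u and no block of length l >= 2 has sum above sqrt(l) u. Take
u^alpha = (log n)/E with E slightly above D: then n P[X_1 > u] -> oo, so
U_n > u with probability tending to 1. Put a = u / sqrt(l).

If a is large, that is l <= const u^2: by convexity of x^alpha, a block sum
above l a forces sum (X_i^+)^alpha >= l a^alpha = l^(1-alpha/2) u^alpha. The
Markov inequality for exp(t sum (X_i^+)^alpha), with t < D chosen so that
t 2^(1-alpha/2) > D (this is where alpha < 2 enters), gives a probability at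
most exp(-D_1 u^alpha) with D_1 > E. There are O(n u^2) such blocks.

If a is bounded, E[exp(s X_1)] <= exp(C s^2) for small s >= 0 and the Chernoff
bound with s proportional to a gives exp(-c u^2). As u^2 >> log n (again because
alpha < 2), this beats the number n^2 of blocks.
*)

(** * Expectations of products of independent variables *)

Lemma measurable_EFin_fun d (T : measurableType d) (R : realType) (D : set T) (f : T -> R) :
  measurable_fun D f -> measurable_fun D (fun x => (f x)%:E).
Proof. by move=> mf; apply/measurable_EFinP. Qed.

(** The last hypothesis is the case where [h] is an indicator. Linearity extends it to simple
    functions, and monotone convergence along [nnsfun_approx] to every nonnegative measurable
    [h]. *)
Lemma integralM_indep (d : measure_display) (T : measurableType d) (R : realType)
  (P : probability T R) (Z Y : T -> R) (h : R -> R) :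
  measurable_fun setT Z -> (forall x, 0 <= Z x) ->
  measurable_fun setT Y ->
  measurable_fun [set: R] h -> (forall y, 0 <= h y) ->
  (\int[P]_x (Z x)%:E < +oo)%E ->
  (forall B, measurable B ->
    \int[P]_x (Z x * \1_(Y @^-1` B) x)%:E = \int[P]_x (Z x)%:E * P (Y @^-1` B))%E ->
  (\int[P]_x (Z x * h (Y x))%:E = \int[P]_x (Z x)%:E * \int[P]_x (h (Y x))%:E)%E.
Proof.
move=> mZ Z0 mY mh h0 Zoo ind.
have mh' : measurable_fun [set: R] (fun y => (h y)%:E) by exact/measurable_EFinP.
have iZ0 : (0 <= \int[P]_x (Z x)%:E)%E by apply: integral_ge0 => x _; rewrite lee_fin.
have fZ : (\int[P]_x (Z x)%:E)%E \is a fin_num by rewrite ge0_fin_numE.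
pose f_ := nnsfun_approx measurableT mh'.
have f_h x : (f_ n x @[n --> \oo] --> h x)%R.
  by have /fine_cvgP[] := @cvg_nnsfun_approx _ _ _ _ measurableT _ mh' (fun x _ => h0 x) x Logic.I.
have nd x : {homo (fun n => f_ n x) : n m / (n <= m)%N >-> n <= m}.
  by move=> n m nm; exact/lefP/nd_nnsfun_approx.
have mf_ n : measurable_fun setT (fun x => f_ n (Y x)).
  by apply: measurableT_comp => //.
have L1 : (\int[P]_x (Z x * f_ n (Y x))%:E @[n --> \oo] --> \int[P]_x (Z x * h (Y x))%:E)%E.
  have := @cvg_monotone_convergence _ _ _ P _ measurableT
     (fun n x => (Z x * f_ n (Y x))%:E).
  move=> /(_ _)/(_ _)/(_ _) => C.
  rewrite (_ : (\int[P]_x (Z x * h (Y x))%:E)%E =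
     (\int[P]_x limn (fun n => (Z x * f_ n (Y x))%:E))%E); last first.
    apply: eq_integral => x _; apply/esym/cvg_lim => //.
    by apply: cvg_EFin; [exact: nearW|apply: cvgMr; exact: f_h].
  apply: C.
  - by move=> n; apply/measurable_EFinP; exact: measurable_funM.
  - by move=> n x _; rewrite lee_fin mulr_ge0.
  - by move=> x _ n m nm; rewrite lee_fin ler_wpM2l// nd.
have L2 : (\int[P]_x (f_ n (Y x))%:E @[n --> \oo] --> \int[P]_x (h (Y x))%:E)%E.
  rewrite (_ : (\int[P]_x (h (Y x))%:E)%E =
     (\int[P]_x limn (fun n => (f_ n (Y x))%:E))%E); last first.
    apply: eq_integral => x _; apply/esym/cvg_lim => //.
    by apply: cvg_EFin; [exact: nearW|exact: f_h].
  apply: cvg_monotone_convergence => //.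
  - by move=> n; apply/measurable_EFinP.
  - by move=> n x _; rewrite lee_fin.
  - by move=> x _ n m nm; rewrite lee_fin nd.
have step n : (\int[P]_x (Z x * f_ n (Y x))%:E
    = \int[P]_x (Z x)%:E * \int[P]_x (f_ n (Y x))%:E)%E.
  have mp r : measurable (Y @^-1` (f_ n @^-1` [set r])).
    by rewrite -[X in measurable X]setTI; exact: mY.
  have r0 r y : 0 <= r * \1_(f_ n @^-1` [set r]) y.
    by have := nnfun_muleindic_ge0 (f_ n) r y; rewrite lee_fin.
  transitivity (\sum_(r \in range (f_ n)) (\int[P]_x (Z x)%:E * \int[P]_x (r * \1_(f_ n @^-1` [set r]) (Y x))%:E)%E)%E.
    transitivity (\sum_(r \in range (f_ n)) \int[P]_x (Z x * (r * \1_(f_ n @^-1` [set r]) (Y x)))%:E)%E.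
      rewrite -ge0_integral_fsum//.
      - apply: eq_integral => x _; rewrite {1}(fimfunE (f_ n)) fsumEFin//.
        by congr EFin; rewrite mulr_fsumr.
      - move=> r; apply/measurable_EFinP/measurable_funM => //.
        by apply: measurable_funM => //; apply: measurableT_comp => //.
      - by move=> r x _; rewrite lee_fin mulr_ge0.
    apply: eq_fsbigr => r _.
    have [rneg|rpos] := ltP r 0.
      rewrite preimage_nnfun0//.
      under eq_integral do rewrite indic0 /cst/= !mulr0.
      under [X in _ = (_ * X)%E]eq_integral do rewrite indic0 /cst/= !mulr0.
      by rewrite !integral0 mule0.
    have i1 (x : T) : \1_(f_ n @^-1` [set r]) (Y x) = \1_(Y @^-1` (f_ n @^-1` [set r])) x :> R.
      by rewrite !indicE.
    have mi : measurable_fun setT (fun x => \1_(Y @^-1` (f_ n @^-1` [set r])) x : R).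
      exact: measurable_indic.
    under eq_integral do rewrite i1 mulrCA EFinM.
    under [X in _ = (_ * X)%E]eq_integral do rewrite i1 EFinM.
    rewrite ge0_integralZl//=; last 2 first.
      by apply: measurable_EFin_fun; apply: measurable_funM.
      by move=> x _; rewrite lee_fin mulr_ge0.
    rewrite ge0_integralZl//=; last exact: measurable_EFin_fun.
    rewrite integral_indic// setIT muleCA; congr (_ * _)%E.
    exact: ind.
  rewrite -ge0_mule_fsumr.
    congr (_ * _)%E; rewrite -ge0_integral_fsum//.
    - by apply: eq_integral => x _; rewrite (fimfunE (f_ n)) fsumEFin.
    - move=> r; apply: measurable_EFin_fun; apply: measurable_funM => //.
      by apply: measurableT_comp => //.
    - by move=> r x _; rewrite lee_fin.
  by move=> r; apply: integral_ge0 => x _; rewrite lee_fin.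
have L3 : (\int[P]_x (Z x * f_ n (Y x))%:E @[n --> \oo] -->
    \int[P]_x (Z x)%:E * \int[P]_x (h (Y x))%:E)%E.
  by under eq_cvg do rewrite step; exact: cvgeZl.
exact: (cvg_unique _ L1 L3).
Qed.

Section iid.
Context (d : measure_display) (T : measurableType d) (R : realType)
  (P : probability T R) (X : nat -> {RV P >-> R}).
Hypothesis indX : mutually_independent P (fun k => X k : T -> R).
Hypothesis idX : identically_distributed P (fun k => X k : T -> R).

Lemma integral_id_distr (f : R -> \bar R) k :
  measurable_fun [set: R] f -> (forall y, 0 <= f y)%E ->
  (\int[P]_x f (X k x) = \int[P]_x f (X 0%N x))%E.
Proof.
move=> mf f0.
rewrite -(ge0_integral_distribution (X k) mf f0).
rewrite -(ge0_integral_distribution (X 0%N) mf f0).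
by apply: eq_measure_integral => B mB _; exact: idX.
Qed.

Lemma probability_bigcap_cons (i : nat) (J : seq nat) (B : nat -> set R) :
  uniq (i :: J) -> (forall j, j \in i :: J -> measurable (B j)) ->
  (P (X i @^-1` B i `&` \big[setI/setT]_(j <- J) (X j @^-1` B j)) =
   P (X i @^-1` B i) * P (\big[setI/setT]_(j <- J) (X j @^-1` B j)))%E.
Proof.
move=> uiJ mB; have := indX uiJ mB; rewrite !big_cons => ->.
rewrite indX//.
  by move: uiJ => /= /andP[].
by move=> j jJ; apply: mB; rewrite inE jJ orbT.
Qed.

(** The events indexed by [J] serve the induction on [I]: to split off the factor of index [i],
    [integralM_indep] asks for factorization against every event of [X i], and this is the induction
    hypothesis with [i] moved into [J]. *)
Lemma integral_prod_indep (g : R -> R) (I J : seq nat) (B : nat -> set R) :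
  measurable_fun [set: R] g -> (forall y, 0 <= g y) ->
  (\int[P]_x (g (X 0%N x))%:E < +oo)%E ->
  uniq (I ++ J) -> (forall j, j \in J -> measurable (B j)) ->
  (\int[P]_x (\prod_(i <- I) g (X i x) *
     \1_(\big[setI/setT]_(j <- J) (X j @^-1` B j)) x)%:E =
   (\int[P]_x (g (X 0%N x))%:E) ^+ size I *
   P (\big[setI/setT]_(j <- J) (X j @^-1` B j)))%E.
Proof.
move=> mg g0 goo.
have mbig (K : seq nat) (C : nat -> set R) : (forall j, j \in K -> measurable (C j)) ->
    measurable (\big[setI/setT]_(j <- K) (X j @^-1` C j)).
  elim: K => [|k K IH] mC; first by rewrite big_nil.
  rewrite big_cons; apply: measurableI.
    by apply: measurable_funPTI; apply: mC; rewrite mem_head.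
  by apply: IH => j jK; apply: mC; rewrite inE jK orbT.
have mgX i : measurable_fun setT (fun x => g (X i x)).
  by apply: measurableT_comp.
elim: I J B => [|i I IH] J B.
  move=> uJ mB /=.
  under eq_integral do rewrite big_nil mul1r.
  by rewrite integral_indic ?setIT ?expe0 ?mul1e//; exact: mbig.
rewrite cat_cons cons_uniq => /andP[iIJ uIJ] mB.
have iI : i \notin I by apply: contra iIJ; rewrite mem_cat => ->.
have iJ : i \notin J by apply: contra iIJ; rewrite mem_cat orbC => ->.
pose Z x := \prod_(i0 <- I) g (X i0 x) * \1_(\big[setI/setT]_(j <- J) (X j @^-1` B j)) x.
have IHJ := IH J B uIJ mB.
have Zfin : (\int[P]_x (Z x)%:E < +oo)%E.
  rewrite IHJ lte_mul_pinfty//.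
  - by apply: expe_ge0; apply: integral_ge0 => x _; rewrite lee_fin.
  - apply: fin_numX. rewrite ge0_fin_numE//.
    by apply: integral_ge0 => x _; rewrite lee_fin.
  - by apply: (le_lt_trans (probability_le1 P (mbig _ _ mB))); rewrite ltry.
under eq_integral => x _ do rewrite big_cons -mulrA mulrC -/(Z x).
rewrite (integralM_indep (Z := Z) (Y := X i)) //.
- rewrite (integral_id_distr (f := fun y => (g y)%:E))//; first by rewrite IHJ [size _]/= expeS muleC muleA.
    exact: measurable_EFin_fun.
- apply: measurable_funM; first by apply: measurable_prod => *.
  by apply: measurable_indic; exact: mbig.
- by move=> x; rewrite mulr_ge0// prodr_ge0.
- move=> C mC.
  pose B' j := if j == i then C else B j.
  have uI' : uniq (I ++ i :: J).
    by rewrite -cat1s uniq_catCA /= iIJ.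
  have mB' j : j \in i :: J -> measurable (B' j).
    by rewrite inE /B'; case: eqP => //= _; exact: mB.
  have bigB' : \big[setI/setT]_(j <- J) (X j @^-1` B' j) = \big[setI/setT]_(j <- J) (X j @^-1` B j).
    by apply: eq_big_seq => j jJ; rewrite /B'; case: eqP jJ iJ => // -> ->.
  have := IH (i :: J) B' uI' mB'.
  rewrite big_cons bigB' /= => E.
  rewrite (_ : \int[P]_x _ = \int[P]_x
     (\prod_(i0 <- I) g (X i0 x) *
         \1_(X i @^-1` B' i `&` \big[setI/setT]_(j <- J) (X j @^-1` B j)) x)%:E)%E; last first.
    by apply: eq_integral => x _; rewrite indicI /Z /B' eqxx -mulrA (mulrC (\1__ x)).
  rewrite E IHJ -bigB' probability_bigcap_cons//; last by rewrite /= iJ; move: uIJ; rewrite cat_uniq => /and3P[].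
  by rewrite /B' eqxx muleA muleAC.
Qed.

End iid.

(** * Markov's inequality for products and the event of no large value *)

Lemma measurable_gtr d (T : measurableType d) (R : realType) (f : T -> R) (u : R) :
  measurable_fun setT f -> measurable [set x | u < f x].
Proof.
move=> mf; rewrite (_ : [set x | _] = f @^-1` `]u, +oo[).
  by rewrite -[X in measurable X]setTI; exact: mf.
by apply/seteqP; split => x /=; rewrite in_itv /= andbT.
Qed.

Section iid_bounds.
Context (d : measure_display) (T : measurableType d) (R : realType)
  (P : probability T R) (X : nat -> {RV P >-> R}).
Hypothesis indX : mutually_independent P (fun k => X k : T -> R).
Hypothesis idX : identically_distributed P (fun k => X k : T -> R).

(** The product divided by [M] dominates the indicator of [A], and independence turns the integral
    of the product into a power. *)
Lemma markov_prod_indep (g : R -> R) (I : seq nat) (A : set T) (M w : R) :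
  measurable_fun [set: R] g -> (forall y, 0 <= g y) ->
  (\int[P]_x (g (X 0%N x))%:E <= w%:E)%E ->
  uniq I -> measurable A -> 0 < M ->
  (forall x, A x -> M <= \prod_(i <- I) g (X i x)) ->
  (P A <= (w ^+ size I / M)%:E)%E.
Proof.
move=> mg g0 gw uI mA M0 AM.
have i0 : (0 <= \int[P]_x (g (X 0%N x))%:E)%E.
  by apply: integral_ge0 => x _; rewrite lee_fin.
have goo : (\int[P]_x (g (X 0%N x))%:E < +oo)%E by rewrite (le_lt_trans gw) ?ltry.
have mprod : measurable_fun setT (fun x => \prod_(i <- I) g (X i x)).
  by apply: measurable_prod => i _; apply: measurableT_comp.
have prod0 x : 0 <= \prod_(i <- I) g (X i x) by rewrite prodr_ge0.
have := @integral_prod_indep _ _ _ _ _ indX idX g I [::] (fun=> setT) mg g0 goo.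
rewrite cats0 => /(_ uI (fun _ _ => measurableT)).
rewrite big_nil probability_setT mule1.
under eq_integral do rewrite indicT mulr1.
move=> E.
have PA : P A = (\int[P]_x (\1_A x)%:E)%E by rewrite integral_indic// setIT.
apply: (@le_trans _ _ (\int[P]_x (M^-1%:E * (\prod_(i <- I) g (X i x))%:E)))%E.
  rewrite PA; apply: ge0_le_integral => //.
  - by apply: measurable_EFin_fun; exact: measurable_indic.
  - under eq_fun do rewrite -EFinM.
    by apply: measurable_EFin_fun; apply: measurable_funM.
  move=> x _; rewrite -EFinM lee_fin indicE.
  have [xA|_] := boolP (x \in A); last by rewrite mulr_ge0// invr_ge0 ltW.
  by rewrite mulrC ler_pdivlMr// mul1r AM//; exact: set_mem.
rewrite ge0_integralZl//=.
- rewrite E mulrC EFinM lee_pmul2l// ?lte_fin ?invr_gt0//.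
  have gfin : (\int[P]_x (g (X 0%N x))%:E)%E \is a fin_num by rewrite ge0_fin_numE.
  rewrite -(fineK gfin) -EFin_expe lee_fin lerXn2r//.
  + by rewrite nnegrE fine_ge0.
  + by rewrite nnegrE -lee_fin (le_trans i0).
  + by rewrite -lee_fin fineK.
- exact: measurable_EFin_fun.
- by move=> x _; rewrite lee_fin.
- by rewrite lee_fin invr_ge0 ltW.
Qed.

(** Independence gives the n-th power of [1 - p], with [p] the probability of exceeding [u], and
    [1 - p <= expR (- p)]. *)
Lemma probability_all_le (n : nat) (u : R) :
  (P (\big[setI/setT]_(i <- iota 0 n) (X i @^-1` `]-oo, u])) <=
   (expR (- (n%:R * fine (P [set x | (u < X 0%N x)%R]))))%:E)%E.
Proof.
have mu k : measurable (X k @^-1` `]-oo, u]) by exact: measurable_funPTI.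
rewrite indX ?iota_uniq//.
have E : P (X 0%N @^-1` `]-oo, u]) = (1 - P [set x | (u < X 0%N x)%R])%E.
  rewrite -probability_setC; last exact: measurable_gtr.
  congr (P _); apply/seteqP; split => x /=; rewrite in_itv /= leNgt; first by move/negP.
  by move=> ?; apply/negP.
have pfin : P [set x | (u < X 0%N x)%R] \is a fin_num.
  by apply: fin_num_measure; exact: measurable_gtr.
rewrite (eq_bigr (fun=> (1 - fine (P [set x | (u < X 0%N x)%R]))%:E)); last first.
  by move=> i _; rewrite (idX i)// E EFinB fineK.
rewrite prodEFin lee_fin big_const_seq iter_mulr_1 count_predT size_iota.
rewrite -mulrN expRM_natl lerXn2r//.
- rewrite nnegrE subr_ge0 -lee_fin fineK//.
  by apply: probability_le1; exact: measurable_gtr.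
- by rewrite nnegrE expR_ge0.
- exact: expR_ge1Dx.
Qed.
End iid_bounds.

(** * Exponential moments and the moment generating function near zero *)

Section exponential_moments.
Context (d : measure_display) (T : measurableType d) (R : realType)
  (P : probability T R).

(** Slicing by integer levels, exp(t Y) is at most 1 plus the sum over k of exp(t (k + 1)) times the
    indicator of [k < Y]. After integration the tail bound leaves a geometric series of ratio exp(t
    - t'). *)
Lemma integral_expR_lty (Y : T -> R) (C t t' : R) :
  measurable_fun setT Y -> (forall x, 0 <= Y x) ->
  0 <= t < t' -> 0 <= C ->
  (forall k : nat, P [set x | (k%:R < Y x)%R] <= (C * expR (- (t' * k%:R)))%:E)%E ->
  (\int[P]_x (expR (t * Y x))%:E < +oo)%E.
Proof.
move=> mY Y0 /andP[t0 tt'] C0 tail.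
have mk (k : nat) : measurable [set x | k%:R < Y x] by exact: measurable_gtr.
pose F (k : nat) (x : T) : \bar R := (expR (t * k.+1%:R) * \1_[set x | k%:R < Y x] x)%:E.
have F0 k x : (0 <= F k x)%E by rewrite lee_fin mulr_ge0// expR_ge0.
have mF k : measurable_fun setT (F k).
  by apply: measurable_EFin_fun; apply: measurable_funM => //; exact: measurable_indic.
have dom x : ((expR (t * Y x))%:E <= 1%:E + \sum_(0 <= k <oo) F k x)%E.
  have S0 n : (0 <= \sum_(0 <= k < n) F k x)%E by apply: sume_ge0.
  have [Yle|Ygt] := leP (Y x) 0.
    have -> : Y x = 0 by apply/eqP; rewrite eq_le Yle Y0.
    by rewrite mulr0 expR0 leeDl// nneseries_ge0.
  have ex : exists n : nat, Y x <= n%:R.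
    by exists (Num.bound (Y x)); rewrite ltW// archi_boundP.
  have [[|k] Yk kmin] := ex_minnP ex; first by move: Ygt; rewrite ltNge Yk.
  have kY : k%:R < Y x by rewrite ltNge; apply/negP => /kmin; rewrite ltnn.
  apply: (@le_trans _ _ (F k x)).
    by rewrite /F indicE mem_set// mulr1 lee_fin ler_expR ler_wpM2l.
  apply: (@le_trans _ _ (\sum_(0 <= k < k.+1) F k x)%E).
    by rewrite big_nat_recr//= leeDr.
  apply: (@le_trans _ _ (\sum_(0 <= k <oo) F k x)%E); last by rewrite leeDr.
  exact: nneseries_lim_ge.
have mS : measurable_fun setT (fun x => \sum_(0 <= k <oo) F k x)%E.
  by apply: ge0_emeasurable_sum.
apply: (@le_lt_trans _ _ (\int[P]_x (1%:E + \sum_(0 <= k <oo) F k x))%E).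
  apply: ge0_le_integral => //.
  - apply: measurable_EFin_fun; apply: measurableT_comp => //.
    exact: measurable_funM.
  - exact: emeasurable_funD.
rewrite ge0_integralD//; last by move=> x _; apply: nneseries_ge0.
rewrite integral_nneseries// integral_cst// mul1e [X in (X + _)%E](_ : _ = 1%E); last exact: probability_setT.
pose q := expR (t - t').
have q1 : `|q| < 1 by rewrite ger0_norm ?expR_ge0// expR_lt1 subr_lt0.
have term k : (\int[P]_x F k x <= (geometric (C * expR t) q k)%:E)%E.
  rewrite /F; under eq_integral do rewrite EFinM.
  rewrite ge0_integralZl//=; last by apply: measurable_EFin_fun; exact: measurable_indic.
  rewrite integral_indic// setIT.
  apply: (@le_trans _ _ ((expR (t * k.+1%:R))%:E * (C * expR (- (t' * k%:R)))%:E)%E).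
    by rewrite lee_wpmul2l// ?lee_fin ?expR_ge0//; exact: tail.
  rewrite -EFinM lee_fin /geometric /= /q -expRM_natr mulrCA -!mulrA -!expRD.
  by rewrite ler_wpM2l// ler_expR -natr1; lra.
apply: (@le_lt_trans _ _ (1 + \sum_(0 <= k <oo) (geometric (C * expR t) q k)%:E)%E).
  by rewrite leeD2l//; apply: lee_nneseries => k _ *; [exact: integral_ge0|exact: term].
have := cvg_geometric_series (a := C * expR t) q1.
move=> cv.
rewrite (_ : \sum_(0 <= k <oo) _ = (C * expR t / (1 - q))%:E)%E; first by rewrite -EFinD ltry.
apply/cvg_lim => //.
under eq_fun do rewrite sumEFin.
by apply: cvg_EFin => //; exact: nearW.
Qed.

Lemma integral_expR_posM_lty (X : {RV P >-> R}) (alpha t t' x0 : R) :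
  0 < alpha -> 0 <= t < t' ->
  (forall x, x0 <= x -> (P [set w | (x < X w)%R] <= (expR (- (t' * x `^ alpha)))%:E)%E) ->
  (\int[P]_x (expR (t * (Num.max (X x) 0) `^ alpha))%:E < +oo)%E.
Proof.
move=> a0 tt' tail.
have t'0 : 0 <= t' by case/andP: tt' => /le_trans h /ltW; exact: h.
have mXa : measurable_fun setT (fun x => (Num.max (X x) 0) `^ alpha).
  by apply: (measurableT_comp (measurable_powR alpha)); exact: measurable_maxr.
(* Beyond [K] the level [z] is at least [x0], so the assumed tail applies; up to [K] the factor
   [expR (t' * K)] makes the required bound at least one, hence trivial. *)
pose K := (Num.max x0 0) `^ alpha.
apply: (@integral_expR_lty _ (expR (t' * K)) t t') => //.
- by move=> x; exact: powR_ge0.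
move=> k.
have [kK|Kk] := leP k%:R K.
  apply: (@le_trans _ _ 1%E).
    apply: probability_le1.
    exact: measurable_gtr.
  by rewrite -expRD lee_fin -[leLHS]expR0 ler_expR -mulrBr mulr_ge0// subr_ge0.
pose z := k%:R `^ alpha^-1 : R.
have zk : z `^ alpha = k%:R by rewrite -powRrM mulVf ?gt_eqF// powRr1.
have x0z : x0 <= z.
  rewrite leNgt; apply/negP => zx0; move: Kk; rewrite ltNge => /negP; apply.
  rewrite -zk; apply: ge0_ler_powR; rewrite ?nnegrE ?powR_ge0 ?(ltW a0)//.
    by rewrite le_max lexx orbT.
  by rewrite le_max ltW.
apply: (@le_trans _ _ (P [set w | (z < X w)%R])).
  apply: le_measure; rewrite ?inE.
  - exact: measurable_gtr.
  - exact: measurable_gtr.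
  - move=> x /=; rewrite -{1}zk => zX; rewrite ltNge; apply/negP => Xz.
    move: zX; rewrite ltNge => /negP; apply.
    apply: ge0_ler_powR; rewrite ?nnegrE ?powR_ge0 ?(ltW a0)//.
      by rewrite le_max lexx orbT.
    by rewrite ge_max Xz powR_ge0.
apply: (le_trans (tail _ x0z)); rewrite zk lee_fin ler_peMl ?expR_ge0//.
by rewrite -[leLHS]expR0 ler_expR mulr_ge0// powR_ge0.
Qed.

End exponential_moments.

(** Put y = s x. If y <= 1/2, then exp y <= 1 + y + 2 y^2. Otherwise 1 < 4 y^2, so exp y <= s^2 (4
    x^2 exp y); both x^2 and exp y are bounded through exp(t x / 2), and x <= 1 + x^alpha concludes.
    The factor of [s ^+ 2] is free of [s], so it integrates to a constant. *)
Lemma expR_le_quadratic (R : realType) (t alpha s x : R) :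
  0 < t -> 1 <= alpha -> 0 <= s <= t / 2 ->
  expR (s * x) <= 1 + s * x + s ^+ 2 *
    (4 * x ^+ 2 + 32 / t ^+ 2 * expR t * expR (t * (Num.max x 0) `^ alpha)).
Proof.
move=> t0 a1 /andP[s0 st].
set K := 32 / t ^+ 2 * expR t * _.
have K0 : 0 <= K by rewrite /K !mulr_ge0 ?expR_ge0// invr_ge0 sqr_ge0.
set y := s * x.
have yE : s ^+ 2 * (4 * x ^+ 2 + K) = 4 * y ^+ 2 + s ^+ 2 * K by rewrite /y; ring.
rewrite yE.
have sK : 0 <= s ^+ 2 * K by rewrite mulr_ge0// sqr_ge0.
have [y2|y2] := leP y (1 / 2).
  have e1 : expR y * (1 - y) <= 1.
    rewrite -[leRHS](expRxMexpNx_1 y) ler_wpM2l ?expR_ge0//.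
    exact: expR_ge1Dx.
  have e2 : 1 <= (1 + y + 2 * y ^+ 2) * (1 - y).
    have -> : (1 + y + 2 * y ^+ 2) * (1 - y) = 1 + y ^+ 2 * (1 - 2 * y) by ring.
    by rewrite lerDl mulr_ge0 ?sqr_ge0//; lra.
  have y1 : 0 < 1 - y by lra.
  have : expR y <= 1 + y + 2 * y ^+ 2.
    by rewrite -(ler_pM2r y1); exact: le_trans e1 e2.
  by have := sqr_ge0 y; lra.
have y0 : 0 < y by lra.
have x0 : 0 < x.
  by move: y0; rewrite /y => y0; rewrite ltNge; apply/negP => xle; have := mulr_ge0_le0 s0 xle; lra.
suff : expR y <= s ^+ 2 * K by have := sqr_ge0 y; lra.
have ey : expR y <= 4 * y ^+ 2 * expR y.
  by rewrite ler_peMl ?expR_ge0//; nra.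
apply: (le_trans ey).
have -> : 4 * y ^+ 2 * expR y = s ^+ 2 * (4 * (x ^+ 2 * expR y)) by rewrite /y; ring.
rewrite ler_wpM2l ?sqr_ge0//.
have x2 : x ^+ 2 <= 8 / t ^+ 2 * expR (t / 2 * x).
  have h : 1 + (t / 2 * x) ^+ 2 / 2 <= expR (t / 2 * x).
    by apply: (@expR_ge1Dxn _ _ 1); rewrite mulr_ge0 ?divr_ge0 ?ltW.
  have -> : x ^+ 2 = 8 / t ^+ 2 * ((t / 2 * x) ^+ 2 / 2).
    by field; rewrite gt_eqF.
  rewrite ler_wpM2l//; first by rewrite divr_ge0// sqr_ge0.
  by apply: le_trans h; rewrite lerDr.
have ey2 : expR y <= expR (t / 2 * x) by rewrite ler_expR /y ler_wpM2r// ltW.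
have xa : x <= 1 + (Num.max x 0) `^ alpha.
  rewrite max_l; last exact: ltW.
  have [x1|x1] := leP x 1; first by have := powR_ge0 x alpha; lra.
  by have := le1r_powR (ltW x1) a1; lra.
have e3 : expR (t / 2 * x) * expR (t / 2 * x) <= expR t * expR (t * (Num.max x 0) `^ alpha).
  by rewrite -!expRD ler_expR; nra.
have := ler_pM (sqr_ge0 x) (expR_ge0 y) x2 ey2.
have c0 : 0 <= 8 / t ^+ 2 by rewrite divr_ge0// sqr_ge0.
have := ler_wpM2l c0 e3.
rewrite /K; lra.
Qed.

Section mgf_bound.
Context (d : measure_display) (T : measurableType d) (R : realType)
  (P : probability T R) (X : {RV P >-> R}).

(** When [expR_le_quadratic] is integrated, the linear term vanishes because the mean is zero, and 1
    + v <= exp v gives the exponential form. The constant is the integral of the factor of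
    [s ^+ 2]. *)
Lemma mgf_le_quadratic (t alpha : R) :
  0 < t -> 1 <= alpha -> (X : T -> R) \in Lfun P 2%:E -> ('E_P[X] = 0)%E ->
  (\int[P]_x (expR (t * (Num.max (X x) 0) `^ alpha))%:E < +oo)%E ->
  exists2 C : R, 0 <= C & forall s, 0 <= s <= t / 2 ->
    (\int[P]_x (expR (s * X x))%:E <= (expR (C * s ^+ 2))%:E)%E.
Proof.
move=> t0 a1 X2 EX Eoo.
have X1 : (X : T -> R) \in Lfun P 1.
  by apply: Lfun_subset12 => //; exact: fin_num_measure.
have iX : P.-integrable setT (EFin \o X) by exact/Lfun1_integrable.
have iX2 := Lfun2_integrable_sqr X2.
pose E x := expR (t * (Num.max (X x) 0) `^ alpha).
have mE : measurable_fun setT E.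
  apply: measurableT_comp => //; apply: measurable_funM => //.
  by apply: (measurableT_comp (measurable_powR alpha)); exact: measurable_maxr.
have iE : P.-integrable setT (EFin \o E).
  apply/integrableP; split; first exact: measurable_EFin_fun.
  by under eq_integral do rewrite /= ger0_norm ?expR_ge0//.
pose c := 32 / t ^+ 2 * expR t.
pose H x := 4 * X x ^+ 2 + c * E x.
have iH : P.-integrable setT (EFin \o H).
  rewrite (_ : EFin \o H = (fun x => 4%:E * (X x ^+ 2)%:E + c%:E * (E x)%:E)%E)//.
  apply: integrableD => //; exact: integrableZl.
have H0 x : 0 <= H x.
  rewrite /H /c; apply: addr_ge0; first by rewrite mulr_ge0// sqr_ge0.
  by rewrite !mulr_ge0 ?expR_ge0// invr_ge0 sqr_ge0.
have iHfin : (\int[P]_x (H x)%:E)%E \is a fin_num by exact: integrable_fin_num.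
exists (fine (\int[P]_x (H x)%:E)).
  by rewrite fine_ge0// integral_ge0// => x _; rewrite lee_fin.
move=> s sle.
have i2 : P.-integrable setT (fun x => s%:E * (X x)%:E + (s ^+ 2)%:E * (H x)%:E)%E.
  by apply: integrableD => //; apply: integrableZl.
have i1 : P.-integrable setT (fun=> 1%:E) := finite_measure_integrable_cst P 1 measurableT.
have i3 : P.-integrable setT (fun x => 1%:E + (s%:E * (X x)%:E + (s ^+ 2)%:E * (H x)%:E))%E.
  exact: integrableD.
apply: (@le_trans _ _ (\int[P]_x (1%:E + (s%:E * (X x)%:E + (s ^+ 2)%:E * (H x)%:E)))%E).
  apply: ge0_le_integral => //.
  - apply: measurable_EFin_fun; apply: measurableT_comp => //; exact: measurable_funM.
  - exact: (measurable_int P).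
  - move=> x _; rewrite -!EFinM -!EFinD lee_fin addrA.
    exact: expR_le_quadratic.
rewrite integralD//=.
rewrite integralD//=; try exact: integrableZl.
rewrite !integralZl// integral_cst// mul1e.
rewrite [X in (X + _)%E](_ : _ = 1%E); last exact: probability_setT.
rewrite -expectation_def EX mule0 add0e -(fineK iHfin) -EFinM -EFinD lee_fin.
by rewrite mulrC; exact: expR_ge1Dx.
Qed.

End mgf_bound.

(** * Convexity of powers and tail bounds for a single block *)

Lemma powR_bernoulli (R : realType) (alpha t : R) :
  1 <= alpha -> 0 <= t -> 1 + alpha * (t - 1) <= t `^ alpha.
Proof.
move=> a1 t0.
(* The general case is Young's inequality for [t] and 1 with exponent [alpha]; the conjugate
   exponent is infinite at [alpha = 1], which is treated apart. *)
have [->|aN1] := eqVneq alpha 1; first by rewrite powRr1//; lra.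
have {a1 aN1} a1 : 1 < alpha by rewrite lt_neqAle eq_sym aN1.
have a0 : 0 < alpha by lra.
have b0 : 0 < 1 - alpha^-1 by rewrite subr_gt0 invf_lt1.
have := @conjugate_powR _ t 1 alpha (1 - alpha^-1)^-1 t0 ler01 a0.
rewrite invr_gt0 => /(_ b0); rewrite invrK addrC subrK => /(_ erefl).
rewrite mulr1 powR1 mul1r => h.
have := ler_wpM2l (ltW a0) h.
rewrite mulrDr mulrBr mulr1 mulfV ?gt_eqF// mulrCA mulfV ?gt_eqF// mulr1.
lra.
Qed.

(* Jensen's inequality for the convex function [(max x 0)^alpha], through its tangent at [a]. *)
Lemma sum_powR_ge (R : realType) (alpha a : R) (I : seq nat) (x : nat -> R) :
  1 <= alpha -> 0 < a -> (size I)%:R * a <= \sum_(i <- I) x i ->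
  (size I)%:R * a `^ alpha <= \sum_(i <- I) (Num.max (x i) 0) `^ alpha.
Proof.
move=> a1 a0 xa.
have pt i : a `^ alpha * (1 + alpha * (x i / a - 1)) <= (Num.max (x i) 0) `^ alpha.
  have m0 : 0 <= Num.max (x i) 0 by rewrite le_max lexx orbT.
  have -> : (Num.max (x i) 0) `^ alpha = a `^ alpha * (Num.max (x i) 0 / a) `^ alpha.
    by rewrite -powRM ?divr_ge0 ?(ltW a0)// mulrC divfK ?gt_eqF.
  rewrite ler_wpM2l ?powR_ge0//.
  apply: le_trans (powR_bernoulli a1 (divr_ge0 m0 (ltW a0))).
  rewrite lerD2l ler_wpM2l ?(le_trans ler01)// lerD2r ler_wpM2r ?invr_ge0 ?(ltW a0)//.
  by rewrite le_max lexx.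
apply: le_trans (ler_sum _ (fun i _ => pt i)).
rewrite -mulr_sumr mulrC ler_wpM2l ?powR_ge0//.
rewrite big_split /= -mulr_sumr sumrB -mulr_suml.
rewrite big_const_seq iter_addr_0 count_predT.
rewrite lerDl; apply: mulr_ge0; first by lra.
by rewrite subr_ge0 ler_pdivlMr.
Qed.

Section block_bounds.
Context (d : measure_display) (T : measurableType d) (R : realType)
  (P : probability T R) (X : nat -> {RV P >-> R}).
Hypothesis indX : mutually_independent P (fun k => X k : T -> R).
Hypothesis idX : identically_distributed P (fun k => X k : T -> R).
Variables (alpha : R) (I : seq nat).
Hypothesis alpha1 : 1 <= alpha.
Hypothesis alpha2 : alpha < 2.
Hypothesis uI : uniq I.
Hypothesis I2 : (1 < size I)%N.

Let l : R := (size I)%:R.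
Let l0 : 0 < l. Proof. by rewrite ltr0n (ltn_trans _ I2). Qed.
Let sl0 : 0 < Num.sqrt l. Proof. by rewrite sqrtr_gt0. Qed.
Let sl2 : Num.sqrt l * Num.sqrt l = l. Proof. by rewrite -expr2 sqr_sqrtr// ltW. Qed.

Lemma measurable_block (u : R) :
  measurable [set x | Num.sqrt l * u < \sum_(i <- I) X i x].
Proof. by apply: measurable_gtr; apply: measurable_sum => i; exact: measurable_funP. Qed.

(** With a = u / sqrt(l), Markov's inequality costs exp(l w) for the moments and gains exp(-t l
    a^alpha). The assumption on [w] bounds the cost by exp(eta l a^alpha), which leaves the rate
    [t - eta]. *)
Lemma block_big_jumps (t eta w u : R) :
  0 < u -> 0 <= eta <= t ->
  (\int[P]_x (expR (t * (Num.max (X 0%N x) 0) `^ alpha))%:E <= (expR w)%:E)%E ->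
  w <= eta * (u / Num.sqrt l) `^ alpha ->
  (P [set x | (Num.sqrt l * u < \sum_(i <- I) X i x)%R] <=
   (expR (- ((t - eta) * 2 `^ (1 - alpha / 2) * u `^ alpha)))%:E)%E.
Proof.
move=> u0 /andP[eta0 etat] Ew wa.
set a := u / Num.sqrt l in wa *.
have a0 : 0 < a by rewrite divr_gt0.
have la : l * a = Num.sqrt l * u.
  by rewrite -{1}sl2 -mulrA (mulrC _ a) /a divfK// gt_eqF.
apply: (@le_trans _ _ (expR w ^+ size I / expR (t * (l * a `^ alpha)))%:E).
  apply: (markov_prod_indep indX idX (g := fun y => expR (t * (Num.max y 0) `^ alpha))) => //.
  - apply: measurableT_comp => //; apply: measurable_funM => //.
    by apply: (measurableT_comp (measurable_powR alpha)); exact: measurable_maxr.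
  - exact: measurable_block.
  - exact: expR_gt0.
  - move=> x /= Sx; rewrite -expR_sum ler_expR -mulr_sumr.
    rewrite ler_wpM2l ?(le_trans eta0)//; apply: sum_powR_ge => //.
    by rewrite -/l la ltW.
rewrite -expRM_natl -expRN -expRD lee_fin ler_expR -/l.
(* Here l a^alpha = l^(1 - alpha/2) u^alpha, with l >= 2 and a nonnegative exponent. *)
have lal : 2 `^ (1 - alpha / 2) * u `^ alpha <= l * a `^ alpha.
  have -> : l * a `^ alpha = l `^ (1 - alpha / 2) * u `^ alpha.
    rewrite /a powRM ?invr_ge0 ?(ltW u0) ?(ltW sl0)//.
    rewrite mulrCA mulrC; congr (_ * _).
    rewrite -powR12_sqrt ?(ltW l0)// -(powR_inv1 (powR_ge0 l 2^-1)) -!powRrM.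
    rewrite -{1}[l]powRr1 ?(ltW l0)// -powRD; last by rewrite (gt_eqF l0) implybT.
    by congr (_ `^ _); lra.
  have e0 : 0 <= 1 - alpha / 2 by have := alpha2; lra.
  by rewrite ler_wpM2r ?powR_ge0//; apply: (ge0_ler_powR e0); rewrite ?nnegrE ?ler_nat ?(ltW l0).
have h1 := ler_wpM2l (ltW l0) wa.
have h2 : 0 <= t - eta by lra.
have h3 := ler_wpM2l h2 lal.
lra.
Qed.

(** Chernoff bound with parameter s a, where a = u / sqrt(l). As l a^2 = u^2, the exponent is (C s -
    1) s u^2, and C s <= 1/2. The condition with [b] keeps s a in the range of the moment
    estimate. *)
Lemma block_gaussian (C s b u : R) :
  0 < u -> 0 <= C -> 0 <= s -> C * s <= 1 / 2 ->
  (forall r, 0 <= r <= b -> (\int[P]_x (expR (r * X 0%N x))%:E <= (expR (C * r ^+ 2))%:E)%E) ->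
  s * (u / Num.sqrt l) <= b ->
  (P [set x | (Num.sqrt l * u < \sum_(i <- I) X i x)%R] <=
   (expR (- (s / 2 * u ^+ 2)))%:E)%E.
Proof.
move=> u0 C0 s0 Cs mgf sab.
set a := u / Num.sqrt l in sab *.
have a0 : 0 < a by rewrite divr_gt0.
have sa0 : 0 <= s * a by rewrite mulr_ge0// ltW.
have ua : Num.sqrt l * a = u by rewrite mulrC divfK// gt_eqF.
apply: (@le_trans _ _ (expR (C * (s * a) ^+ 2) ^+ size I / expR (s * a * (Num.sqrt l * u)))%:E).
  apply: (markov_prod_indep indX idX (g := fun y => expR (s * a * y))) => //.
  - by apply: measurableT_comp => //; exact: measurable_funM.
  - by apply: mgf; rewrite sa0.
  - exact: measurable_block.
  - exact: expR_gt0.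
  - move=> x /= Sx; rewrite -expR_sum ler_expR -mulr_sumr.
    by rewrite ler_wpM2l// ltW.
rewrite -expRM_natl -expRN -expRD lee_fin ler_expR -/l.
have -> : l * (C * (s * a) ^+ 2) = C * s * s * u ^+ 2 by rewrite -sl2 -ua; ring.
have -> : s * a * (Num.sqrt l * u) = s * u ^+ 2 by rewrite -[in RHS]ua -[in LHS]ua; ring.
have := ler_wpM2r (mulr_ge0 s0 (sqr_ge0 u)) Cs; lra.
Qed.

End block_bounds.

(** * Measurability, comparison of the two maxima, and the union bound *)

Lemma measurable_bigmaxe d (T : measurableType d) (R : realType) (s : seq nat)
    (f : nat -> T -> \bar R) :
  (forall i, measurable_fun setT (f i)) ->
  measurable_fun setT (fun x => \big[maxe/-oo%E]_(i <- s) f i x).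
Proof.
move=> mf; elim: s => [|i s IH].
  by under eq_fun do rewrite big_nil; exact: measurable_cst.
by under eq_fun do rewrite big_cons; exact: measurable_maxe.
Qed.

Lemma sum_nat_indic_le (R : realDomainType) (q : R) (j : nat) :
  0 <= q -> \sum_(i < j) (i.+1%:R <= q)%R%:R <= q.
Proof.
(* The trivial bound by [j] is carried along: when j + 1 <= q, it is what yields the bound by [q] at
   the next step. *)
move=> q0; suff [] : \sum_(i < j) (i.+1%:R <= q)%R%:R <= q /\
    \sum_(i < j) (i.+1%:R <= q)%R%:R <= j%:R :> R by [].
elim: j => [|j [IH1 IH2]]; first by rewrite big_ord0.
rewrite big_ord_recr /=; have [jq|jq] := boolP (j.+1%:R <= q); last first.
  by rewrite mulr0n addr0; split => //; rewrite (le_trans IH2)// ler_nat.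
have h : \sum_(i < j) (i.+1%:R <= q)%R%:R + 1 <= j.+1%:R :> R by rewrite -natr1 lerD2r.
by rewrite mulr1n; split => //; exact: le_trans h jq.
Qed.

Section scan.
Context (d : measure_display) (T : measurableType d) (R : realType)
  (P : probability T R) (X : nat -> {RV P >-> R}).
Local Notation M n := (Mmax (fun k => X k : T -> R) n).
Local Notation U n := (Umax (fun k => X k : T -> R) n).

Lemma SsumB i j w : (i <= j)%N ->
  Ssum (fun k => X k : T -> R) j w - Ssum (fun k => X k : T -> R) i w =
  \sum_(k <- index_iota i j) X k w.
Proof.
move=> ij; rewrite /Ssum -!(big_mkord predT (fun k => X k w)).
by rewrite (big_cat_nat _ ij)//= addrAC subrr add0r.
Qed.

Lemma measurable_Mmax_eq_Umax n : measurable [set w | M n w = U n w].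
Proof.
have mU : measurable_fun setT (U n).
  rewrite /Umax; under eq_fun do rewrite -(big_mkord predT (fun k => (X k _)%:E)).
  by apply: measurable_bigmaxe => i; exact: measurable_EFin_fun.
have mM : measurable_fun setT (M n).
  rewrite /Mmax.
  under eq_fun do rewrite -(big_mkord predT (fun j => \big[maxe/-oo%E]_(i < j)
     ((Ssum (fun k => X k : T -> R) j _ - Ssum (fun k => X k : T -> R) i _) /
       Num.sqrt ((j - i)%:R))%:E)).
  apply: measurable_bigmaxe => j.
  under eq_fun do rewrite -(big_mkord predT (fun i =>
     ((Ssum (fun k => X k : T -> R) j _ - Ssum (fun k => X k : T -> R) i _) /
       Num.sqrt ((j - i)%:R))%:E)).
  apply: measurable_bigmaxe => i; apply: measurable_EFin_fun.
  apply: measurable_funM => //; apply: measurable_funB;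
    apply: measurable_sum => k; exact: measurable_funP.
by have := measurable_eqe measurableT mM mU; rewrite setTI.
Qed.

Lemma Umax_le_Mmax n w : (U n w <= M n w)%E.
Proof.
apply: bigmax_le => [|k _]; first exact: leNye.
have kn : (k.+1 < n.+1)%N by rewrite ltnS.
apply: le_trans (le_bigmax _ _ (Ordinal kn)) => /=.
apply: le_trans (le_bigmax _ _ (Ordinal (ltnSn k))) => /=.
by rewrite SsumB// /index_iota subSnn /= big_seq1 sqrtr1 divr1.
Qed.

Lemma Mmax_eq_Umax n w (u : R) :
  (exists2 k, (k < n)%N & u < X k w) ->
  (forall i j, (j <= n)%N -> (i.+1 < j)%N ->
     \sum_(k <- index_iota i j) X k w <= Num.sqrt (j - i)%:R * u) ->
  M n w = U n w.
Proof.
move=> [k kn uX] H; apply/eqP; rewrite eq_le Umax_le_Mmax andbT.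
have Uk i : (i < n)%N -> ((X i w)%:E <= U n w)%E.
  by move=> i_n; apply: le_trans (le_bigmax _ _ (Ordinal i_n)).
apply: bigmax_le => [|j _]; first exact: leNye.
apply: bigmax_le => [|i _]; first exact: leNye.
have ij := ltn_ord i; have jn : (j <= n)%N by rewrite -ltnS.
rewrite SsumB; last exact: ltnW.
move: ij jn; move: (nat_of_ord i) => {}i; move: (nat_of_ord j) => {}j ij jn.
have [ij1|] := ltnP i.+1 j; last first.
  move=> ji; have {ji} ji : j = i.+1 by apply/eqP; rewrite eqn_leq ji.
  rewrite ji /index_iota subSnn /= big_seq1 sqrtr1 divr1.
  by apply: Uk; exact: (leq_trans ij jn).
apply: le_trans (Uk _ kn); rewrite lee_fin; apply: le_trans (ltW uX).
rewrite ler_pdivrMr; last by rewrite sqrtr_gt0 ltr0n subn_gt0.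
by rewrite mulrC; exact: H.
Qed.

End scan.

Section union_bound.
Context (d : measure_display) (T : measurableType d) (R : realType)
  (P : probability T R) (X : nat -> {RV P >-> R}).
Hypothesis indX : mutually_independent P (fun k => X k : T -> R).
Hypothesis idX : identically_distributed P (fun k => X k : T -> R).

(** Failure requires that the first [n] variables all stay at or below [u], or that some block of
    length at least two passes its threshold. For each of the n + 1 right ends, at most [q] lengths
    pay [A] and at most [n] pay [B]. *)
Lemma probability_Mmax_eq_Umax_ge (n : nat) (u q A B : R) :
  0 <= q -> 0 <= A -> 0 <= B ->
  (forall I : seq nat, uniq I -> (1 < size I)%N ->
    (P [set x | (Num.sqrt (size I)%:R * u < \sum_(i <- I) X i x)%R] <=
     (A * ((size I)%:R <= q)%R%:R + B)%:E)%E) ->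
  ((1 - (expR (- (n%:R * fine (P [set x | (u < X 0%N x)%R]))) +
     n.+1%:R * (A * q + n%:R * B)))%:E <=
   P [set w | Mmax (fun k => X k : T -> R) n w = Umax (fun k => X k : T -> R) n w])%E.
Proof.
move=> q0 A0 B0 block.
set G := [set w | Mmax _ _ w = _].
have mG : measurable G by exact: measurable_Mmax_eq_Umax.
pose L := \big[setI/setT]_(i <- iota 0 n) (X i @^-1` `]-oo, u]).
have mL : measurable L.
  by apply: big_ind => // *; [exact: measurableI|exact: measurable_funPTI].
(* Blocks of length one get the empty event, so that the unions run over all [i < j]. *)
pose E i j := if (i.+1 < j)%N
  then [set x | Num.sqrt (size (index_iota i j))%:R * u < \sum_(k <- index_iota i j) X k x]
  else set0.
have mE i j : measurable (E i j).
  rewrite /E; case: ifP => // _; apply: measurable_gtr.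
  by apply: measurable_sum => k; exact: measurable_funP.
pose V j := \big[setU/set0]_(i < j) E i j.
have mV j : measurable (V j) by apply: bigsetU_measurable.
pose W := \big[setU/set0]_(j < n.+1) V j.
have mW : measurable W by apply: bigsetU_measurable.
have PE i j : (i < j)%N -> (P (E i j) <= (A * ((j - i)%:R <= q)%R%:R + B)%:E)%E.
  move=> ij; rewrite /E; case: ifP => ij1; last first.
    by rewrite measure0 lee_fin addr_ge0// mulr_ge0.
  have := block (index_iota i j); rewrite size_iota; apply; first exact: iota_uniq.
  by rewrite ltn_subRL addn1.
have PV j : (j < n.+1)%N -> (P (V j) <= (A * q + n%:R * B)%:E)%E.
  move=> jn; apply: (@le_trans _ _ (\sum_(i < j) P (E i j))%E).
    exact: (@Boole_inequality _ _ _ P (E^~ j)).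
  apply: (@le_trans _ _ (\sum_(i < j) (A * ((j - i)%:R <= q)%R%:R + B)%:E)%E).
    by apply: lee_sum => i _; exact: PE.
  rewrite sumEFin lee_fin big_split /= lerD//.
    rewrite -mulr_sumr ler_wpM2l//.
    (* Reversing the index turns the length [j - i] into [i.+1], the form counted by
       [sum_nat_indic_le]. *)
    rewrite (reindex_inj rev_ord_inj) /=.
    under eq_bigr => i _ do rewrite subKn//.
    exact: sum_nat_indic_le.
  by rewrite sumr_const card_ord -[leLHS]mulr_natl ler_wpM2r// ler_nat -ltnS.
have PW : (P W <= (n.+1%:R * (A * q + n%:R * B))%:E)%E.
  apply: (@le_trans _ _ (\sum_(j < n.+1) P (V j))%E).
    exact: (@Boole_inequality _ _ _ P V).
  apply: (@le_trans _ _ (\sum_(j < n.+1) (A * q + n%:R * B)%:E)%E).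
    by apply: lee_sum => j _; exact: PV.
  by rewrite sumEFin lee_fin sumr_const card_ord -[leLHS]mulr_natl.
have GLW : ~` G `<=` L `|` W.
  apply: subsetCl => w /not_orP[nL nW].
  apply: (@Mmax_eq_Umax _ _ _ _ _ n w u).
    apply: contrapT => nex; apply: nL.
    rewrite /L -bigcap_seq => i /=; rewrite mem_iota add0n => /= i_n.
    by rewrite in_itv /= leNgt; apply/negP => uX; apply: nex; exists i.
  move=> i j jn ij; rewrite leNgt; apply/negP => H; apply: nW.
  have jn1 : (j < n.+1)%N by rewrite ltnS.
  rewrite /W -bigcup_mkord; exists j => //=; rewrite /V -(bigcup_mkord j (E^~ j)).
  by exists i => /=; [exact: ltnW|rewrite /E ij /= size_iota].
have PG : (P (~` G) <= (expR (- (n%:R * fine (P [set x | (u < X 0%N x)%R]))) +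
     n.+1%:R * (A * q + n%:R * B))%:E)%E.
  apply: (@le_trans _ _ (P (L `|` W))).
    by apply: le_measure; rewrite ?inE//; [exact: measurableC|exact: measurableU].
  apply: (le_trans (measureU2 _ mL mW)).
  by rewrite EFinD leeD//; exact: probability_all_le.
have Gfin : P G \is a fin_num by exact: fin_num_measure.
move: PG; rewrite probability_setC// -(fineK Gfin) -EFinB !lee_fin.
lra.
Qed.

End union_bound.

(** * Elementary estimate of the total error *)

Lemma expRN_le_inv (R : realType) (x : R) : 0 < x -> expR (- x) <= x^-1.
Proof.
move=> x0; rewrite expRN lef_pV2 ?posrE ?expR_gt0//.
by have := expR_ge1Dx x; lra.
Qed.

(* Here [y] is [u^alpha] and [n = exp (E y)]; [y `^ alpha^-1] is the level [u]. *)
Lemma error_le (R : realType) (alpha E e a s y p : R) (n : nat) :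
  1 <= alpha < 2 -> 0 < e -> 0 < E -> 0 < a -> 1 <= y ->
  2 * E + 1 <= s / 2 * y `^ (2 / alpha - 1) ->
  n%:R = expR (E * y) -> expR (- ((E - e) * y)) <= p ->
  expR (- (n%:R * p)) + n.+1%:R * (expR (- ((E + e) * y)) * (y `^ alpha^-1 / a) ^+ 2 +
    n%:R * expR (- (s / 2 * (y `^ alpha^-1) ^+ 2))) <=
  (e^-1 + 12 / (a ^+ 2 * e ^+ 3) + 2) / y.
Proof.
move=> /andP[a1 a2] e0 E0 a0 y1 sy nE pE.
have y0 : 0 < y by lra.
have al0 : 0 < alpha by lra.
have u2 : (y `^ alpha^-1) ^+ 2 = y `^ (2 / alpha).
  by rewrite -powR_mulrn ?powR_ge0// -powRrM mulrC.
have u2y : y `^ (2 / alpha) = y * y `^ (2 / alpha - 1).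
  have -> : 2 / alpha = 1 + (2 / alpha - 1) by rewrite addrC subrK.
  rewrite powRD; last by rewrite (gt_eqF y0) implybT.
  by rewrite powRr1 ?(ltW y0)// [1 + _]addrC addrK.
have u2le : y `^ (2 / alpha) <= y ^+ 2.
  rewrite -powR_mulrn ?(ltW y0)//; apply: ler_powR => //.
  by rewrite ler_pdivrMr//; lra.
have n1 : 1 <= n%:R :> R.
  by rewrite nE -[leLHS]expR0 ler_expR mulr_ge0 ?ltW.
have n2 : n.+1%:R <= 2 * n%:R :> R by rewrite -natr1; lra.
(* Since n = exp(E y), the expected number [n%:R * p] of large values is at least exp(e y), hence at
   least e y. *)
have T1 : expR (- (n%:R * p)) <= e^-1 / y.
  have h : e * y <= n%:R * p.
    apply: (@le_trans _ _ (n%:R * expR (- ((E - e) * y)))); last by rewrite ler_wpM2l.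
    rewrite nE -expRD; have -> : E * y + - ((E - e) * y) = e * y by ring.
    by have := expR_ge1Dx (e * y); lra.
  have := expRN_le_inv (mulr_gt0 e0 y0); rewrite invfM; apply: le_trans.
  by rewrite ler_expR lerN2.
(* With n + 1 <= 2 n the exponentials combine to 2 exp(-e y). The squared level is at most y^2, and
   exp(-e y) <= 6 / (e y)^3 leaves order 1 / y. *)
have T2 : n.+1%:R * (expR (- ((E + e) * y)) * (y `^ alpha^-1 / a) ^+ 2) <=
    12 / (a ^+ 2 * e ^+ 3) / y.
  apply: (@le_trans _ _ (2 * expR (- (e * y)) * (y ^+ 2 / a ^+ 2))).
    rewrite mulrA; apply: ler_pM => //.
    - exact: sqr_ge0.
    - apply: (@le_trans _ _ (2 * n%:R * expR (- ((E + e) * y)))).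
        by rewrite ler_wpM2r// expR_ge0.
      rewrite -mulrA ler_wpM2l// nE -expRD.
      by rewrite le_eqVlt; apply/orP; left; apply/eqP; congr expR; ring.
    - by rewrite expr_div_n u2 ler_wpM2r// invr_ge0 sqr_ge0.
  have ey0 : 0 < e * y by rewrite mulr_gt0.
  have h : expR (- (e * y)) <= 6 / (e * y) ^+ 3.
    have := @expR_ge1Dxn R (e * y) 2 (ltW ey0) => h.
    rewrite expRN -[leRHS]invrK lef_pV2 ?posrE ?expR_gt0 ?invr_gt0 ?divr_gt0 ?exprn_gt0//.
    rewrite invf_div; apply: le_trans h.
    by rewrite lerDr.
  have -> : 12 / (a ^+ 2 * e ^+ 3) / y = 2 * (6 / (e * y) ^+ 3) * (y ^+ 2 / a ^+ 2).
    by field; rewrite !gt_eqF.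
  by rewrite ler_wpM2r ?divr_ge0 ?sqr_ge0// ler_wpM2l.
(* By [sy] the Gaussian exponent is at least (2 E + 1) y; the two factors of order n consume 2 E y
   and leave exp(-y). *)
have T3 : n.+1%:R * (n%:R * expR (- (s / 2 * (y `^ alpha^-1) ^+ 2))) <= 2 / y.
  apply: (@le_trans _ _ (2 * n%:R * (n%:R * expR (- ((2 * E + 1) * y))))).
    apply: ler_pM => //.
    rewrite ler_wpM2l// ler_expR lerN2 u2 u2y.
    by rewrite mulrCA mulrC ler_wpM2l// ltW.
  have -> : 2 * n%:R * (n%:R * expR (- ((2 * E + 1) * y))) = 2 * expR (- y).
    rewrite nE -!mulrA; congr (_ * _); rewrite mulrA -!expRD; congr expR; ring.
  by rewrite ler_wpM2l// expRN_le_inv.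
by rewrite mulrDr addrA; apply: le_trans (lerD (lerD T1 T2) T3) _; rewrite -!mulrDl.
Qed.

(** * The tail of X_1 and the constants of the block estimate *)

Section tail.
Context (d : measure_display) (T : measurableType d) (R : realType)
  (P : probability T R) (X : {RV P >-> R}) (alpha D : R).
Hypothesis alpha0 : 0 < alpha.
Hypothesis tailX : (fun x : R => ln (fine (P [set w | x < X w])) / x `^ alpha)
    @ +oo --> - D.

Lemma tail_le (D0 : R) : 0 < D0 < D ->
  \forall x \near +oo, fine (P [set w | x < X w]) <= expR (- (D0 * x `^ alpha)).
Proof.
move=> /andP[D00 D0D].
have ltD : - D < - D0 by rewrite ltrN2.
near=> x.
have x0 : 0 < x by near: x; exact: nbhs_pinfty_gt.
have : ln (fine (P [set w | x < X w])) / x `^ alpha < - D0.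
  by near: x; exact: (cvgr_lt _ tailX).
rewrite ltr_pdivrMr ?powR_gt0//.
have [p0 h|p0 _] := ltP 0 (fine (P [set w | x < X w])).
  by rewrite -[leLHS]lnK ?posrE// ler_expR -mulNr ltW.
by rewrite (le_trans p0)// expR_ge0.
Unshelve. all: by end_near. Qed.

Lemma tail_ge (D2 : R) : 0 < D < D2 ->
  \forall x \near +oo, expR (- (D2 * x `^ alpha)) <= fine (P [set w | x < X w]).
Proof.
move=> /andP[D0 DD2].
have ltD : - D2 < - D by rewrite ltrN2.
have lt0 : - D < 0 by rewrite oppr_lt0.
near=> x.
have x0 : 0 < x by near: x; exact: nbhs_pinfty_gt.
have : - D2 < ln (fine (P [set w | x < X w])) / x `^ alpha.
  by near: x; exact: (cvgr_gt _ tailX).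
(* As [ln] is 0 at 0 by convention, the lower bound on the quotient does not exclude a vanishing
   tail; strict negativity does. *)
have : ln (fine (P [set w | x < X w])) / x `^ alpha < 0.
  by near: x; exact: (cvgr_lt _ tailX).
have xa : 0 < x `^ alpha by exact: powR_gt0.
have [p0 _|p0] := ltP 0 (fine (P [set w | x < X w])).
  rewrite ltr_pdivlMr// mulNr => h.
  by rewrite -[leRHS]lnK ?posrE// ler_expR ltW.
by rewrite ln0// mul0r ltxx.
Unshelve. all: by end_near. Qed.

End tail.

Lemma cvg_ln_natr_div (R : realType) (E : R) : 0 < E ->
  ln (n%:R : R) / E @[n --> \oo] --> +oo.
Proof.
move=> E0; apply/cvgryPge => M; near=> n.
have nM : expR (M * E) <= n%:R by near: n; exact: nbhs_infty_ger.
have n0 : 0 < n%:R :> R by apply: lt_le_trans nM; exact: expR_gt0.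
by rewrite ler_pdivlMr// -ler_expR lnK ?posrE.
Unshelve. all: by end_near. Qed.

(** Comparing u / sqrt(l) with [a] decides between [block_big_jumps] and [block_gaussian]. The gain
    is [D1 > D]: a short block passing its threshold is rarer, on the exponential scale, than a
    single value above [u]. *)
Lemma block_le (d : measure_display) (T : measurableType d) (R : realType)
  (P : probability T R) (X : nat -> {RV P >-> R}) (alpha D : R) :
  mutually_independent P (fun k => X k : T -> R) ->
  identically_distributed P (fun k => X k : T -> R) ->
  (X 0%N : T -> R) \in Lfun P 2%:E ->
  ('E_P[X 0%N] = 0)%E ->
  1 <= alpha < 2 -> 0 < D ->
  (fun x : R => ln (fine (P [set w | x < X 0%N w])) / x `^ alpha)
    @ +oo --> - D ->
  exists D1 a s : R, [/\ D < D1, 0 < a, 0 < s &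
    forall u (I : seq nat), 0 < u -> uniq I -> (1 < size I)%N ->
    (P [set x | (Num.sqrt (size I)%:R * u < \sum_(i <- I) X i x)%R] <=
     (expR (- (D1 * u `^ alpha)) * ((size I)%:R <= (u / a) ^+ 2)%R%:R +
      expR (- (s / 2 * u ^+ 2)))%:E)%E].
Proof.
move=> indX idX X2 EX /andP[a1 a2] D0 tailX.
have al0 : 0 < alpha by lra.
(* The gain of a block of length at least 2 over a single variable. As [r > 1], some [t] below [D]
   still has [t * r > D], which leaves room for [D1]. *)
pose r : R := 2 `^ (1 - alpha / 2).
have r1 : 1 < r.
  rewrite /r -[ltLHS](powRr0 2) /powR pnatr_eq0 /= ltr_expR ltr_pM2r ?ln_gt0 ?ltr1n//.
  by lra.
have r0 : 0 < r by lra.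
have Dr : D / r < D by rewrite ltr_pdivrMr// ltr_pMr.
pose t := (D / r + D) / 2.
have Dr0 : 0 < D / r by exact: divr_gt0.
have t0 : 0 < t by rewrite /t; lra.
have tD : t < D by rewrite /t; lra.
have Drt : D / r < t by rewrite /t; lra.
have Dtr : D < t * r by rewrite -ltr_pdivrMr.
pose D1 := (D + t * r) / 2.
have DD1 : D < D1 by rewrite /D1; lra.
have D1t : D1 < t * r by rewrite /D1; lra.
(* Chosen so that (t - eta) r = D1, the rate given by [block_big_jumps]. *)
pose eta := t - D1 / r.
have eta0 : 0 < eta by rewrite /eta subr_gt0 ltr_pdivrMr.
have etat : eta <= t by rewrite /eta gerBl divr_ge0// ltW//; lra.
pose t' := (t + D) / 2.
have [x0 [_ tail0]] : \forall x \near +oo, fine (P [set w | x < X 0%N w]) <= expR (- (t' * x `^ alpha)).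
  by apply: tail_le tailX _ _ => //; rewrite /t'; lra.
have W : (\int[P]_x (expR (t * (Num.max (X 0%N x) 0) `^ alpha))%:E < +oo)%E.
  apply: (@integral_expR_posM_lty _ _ _ _ _ _ _ t' (x0 + 1)) => //.
    by rewrite /t'; lra.
  move=> x x0x; rewrite -[leLHS]fineK; last first.
    by apply: fin_num_measure; exact: measurable_gtr.
  by rewrite lee_fin; apply: tail0; lra.
have [C C0 mgf] := mgf_le_quadratic t0 a1 X2 EX W.
have W0 : (0 <= \int[P]_x (expR (t * (Num.max (X 0%N x) 0) `^ alpha))%:E)%E.
  by apply: integral_ge0 => x _; rewrite lee_fin expR_ge0.
have Wfin : (\int[P]_x (expR (t * (Num.max (X 0%N x) 0) `^ alpha))%:E)%E \is a fin_num.
  by rewrite ge0_fin_numE.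
(* The added 1 makes [w], and with it [a], positive. *)
pose w := fine (\int[P]_x (expR (t * (Num.max (X 0%N x) 0) `^ alpha))%:E) + 1.
have w0 : 0 < w by rewrite /w ltr_wpDl// fine_ge0.
have Ww : (\int[P]_x (expR (t * (Num.max (X 0%N x) 0) `^ alpha))%:E <= (expR w)%:E)%E.
  by rewrite -[leLHS](fineK Wfin) lee_fin /w; have := expR_ge1Dx w; rewrite /w; lra.
(* Solves eta a^alpha = w, so that the moment condition of [block_big_jumps] holds once u / sqrt(l)
   >= a. *)
pose a := (w / eta) `^ alpha^-1.
have aw : a `^ alpha = w / eta by rewrite /a -powRrM mulVf ?gt_eqF// powRr1// divr_ge0 ?ltW.
have a0 : 0 < a by rewrite powR_gt0// divr_gt0.
(* The first entry gives C s <= 1/2, with [C + 1] to avoid a zero denominator; the second keeps the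
   Chernoff parameter within t / 2 when u / sqrt(l) < a. *)
pose s := Num.min (1 / (2 * (C + 1))) (t / 2 / a).
have s0 : 0 < s.
  by rewrite lt_min !divr_gt0//; lra.
have sC : C * s <= 1 / 2.
  apply: (@le_trans _ _ ((C + 1) * (1 / (2 * (C + 1))))).
    by apply: ler_pM => //; [exact: ltW|lra|rewrite ge_min lexx].
  rewrite le_eqVlt; apply/orP; left; apply/eqP; field.
  by rewrite gt_eqF//; lra.
have sa : s * a <= t / 2 by rewrite -ler_pdivlMr// ge_min lexx orbT.
exists D1, a, s; split=> // u I u0 uI I2.
have sI0 : 0 < Num.sqrt (size I)%:R :> R by rewrite sqrtr_gt0 ltr0n (ltn_trans _ I2).
have [au|ua] := leP a (u / Num.sqrt (size I)%:R).
  apply: (le_trans (block_big_jumps (t := t) (eta := eta) (w := w) indX idX a1 a2 uI I2 u0 _ Ww _)).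
  - by rewrite ltW.
  - rewrite mulrC -ler_pdivrMr// -aw; apply: ge0_ler_powR => //.
    + exact: ltW.
    + by rewrite nnegrE ltW.
    + by rewrite nnegrE divr_ge0 ?ltW.
  (* The condition on u / sqrt(l) amounts to l <= (u / a)^2, so the indicator is one in this
     regime. *)
  - have -> : ((size I)%:R <= (u / a) ^+ 2).
      have := au; rewrite ler_pdivlMr// mulrC -ler_pdivlMr// => h.
      by rewrite -[leLHS](sqr_sqrtr (ler0n _ _)) lerXn2r ?nnegrE ?divr_ge0 ?(ltW sI0) ?(ltW u0) ?(ltW a0).
    rewrite mulr1 lee_fin -/r (_ : t - eta = D1 / r); last by rewrite /eta opprB addrC subrK.
    by rewrite divfK ?gt_eqF// lerDl expR_ge0.
apply: (le_trans (block_gaussian (C := C) (s := s) (b := t / 2) indX idX uI I2 u0 C0 (ltW s0) sC mgf _)).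
  by apply: le_trans sa; rewrite ler_wpM2l// ltW.
by rewrite lee_fin lerDr mulr_ge0// expR_ge0.
Qed.

(** * Choice of the level and passage to the limit *)

Unset Implicit Arguments.

Theorem theorem1p7 (d : measure_display) (T : measurableType d) (R : realType)
  (P : probability T R) (X : nat -> {RV P >-> R}) (alpha D : R) :
  mutually_independent P (fun k => X k : T -> R) ->
  identically_distributed P (fun k => X k : T -> R) ->
  (X 0%N : T -> R) \in Lfun P 2%:E ->
  ('E_P[X 0%N] = 0)%E ->
  ('V_P[X 0%N] = 1)%E ->
  1 <= alpha < 2 -> 0 < D ->
  (fun x : R => ln (fine (P [set w | x < X 0%N w])) / x `^ alpha)
    @ +oo --> - D ->
  (fun n : nat => P [set w | Mmax (fun k => X k : T -> R) n w
                             = Umax (fun k => X k : T -> R) n w])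
    @ \oo --> 1%E.
Proof.
move=> indX idX X2 EX _ a12 D0 tailX.
have [D1 [a [s [DD1 a0 s0 block]]]] := block_le indX idX X2 EX a12 D0 tailX.
have /andP[a1 a2] := a12.
have al0 : 0 < alpha by lra.
(* A third of the gap leaves a margin on both sides: E - e = D + e exceeds [D], as [tail_ge]
   requires, and E + e = D1. *)
pose e := (D1 - D) / 3; pose E := D + 2 * e.
have e0 : 0 < e by rewrite /e; lra.
have E0 : 0 < E by rewrite /E; lra.
have D1E : D1 = E + e by rewrite /E /e; lra.
have [x0 [_ tail]] : \forall x \near +oo,
    expR (- ((E - e) * x `^ alpha)) <= fine (P [set w | x < X 0%N w]).
  by apply: tail_ge tailX _ _ => //; rewrite D0 /E; lra.
pose y (n : nat) := ln (n%:R : R) / E.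
have yoo : y n @[n --> \oo] --> +oo by exact: cvg_ln_natr_div.
pose K := e^-1 + 12 / (a ^+ 2 * e ^+ 3) + 2.
pose c := (2 * E + 1) / (s / 2).
have c0 : 0 <= c by rewrite /c !divr_ge0 ?ltW//; lra.
have b0 : 0 < 2 / alpha - 1 by rewrite subr_gt0 ltr_pdivlMr// mul1r.
apply: (@squeeze_cvge _ _ _ _ (fun n => (1 - K / y n)%:E) _ (fun=> 1%E)); last first.
- exact: cvg_cst.
- apply: cvg_EFin; first exact: nearW.
  rewrite -[X in _ --> X]subr0; apply: cvgB; first exact: cvg_cst.
  rewrite -(mulr0 K); apply: cvgMr.
  apply/gtr0_cvgV0 => //.
  by near=> n; apply: (@lt_le_trans _ _ 1) => //; near: n; move/cvgryPge : yoo; apply.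
near=> n.
have n0 : 0 < n%:R :> R by rewrite ltr0n; near: n; exists 1%N.
have y1 : 1 <= y n by near: n; move/cvgryPge : yoo; apply.
have y0 : 0 < y n by lra.
pose u := y n `^ alpha^-1.
have u0 : 0 < u by exact: powR_gt0.
have uy : u `^ alpha = y n by rewrite /u -powRrM mulVf ?gt_eqF// powRr1// ltW.
have nE : n%:R = expR (E * y n) :> R.
  by rewrite /y mulrC divfK ?gt_eqF// lnK ?posrE.
have x0u : x0 < u.
  (* The level passes [x0] eventually; the maximum with 0 keeps the base nonnegative, where the
     power is increasing. *)
  have : (Num.max x0 0 + 1) `^ alpha <= y n by near: n; move/cvgryPge : yoo; apply.
  move=> h; rewrite ltNge; apply/negP => ux.
  have : u `^ alpha < (Num.max x0 0 + 1) `^ alpha.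
    apply: gt0_ltr_powR => //; rewrite ?nnegrE ?(ltW u0)//.
      by rewrite addr_ge0// le_max lexx orbT.
    by rewrite (le_lt_trans ux)// ltr_pwDr// le_max lexx.
  by rewrite uy ltNge h.
have cy : 2 * E + 1 <= s / 2 * y n `^ (2 / alpha - 1).
  rewrite [leRHS]mulrC -ler_pdivrMr ?divr_gt0// -/c.
  have : c `^ (2 / alpha - 1)^-1 <= y n by near: n; move/cvgryPge : yoo; apply.
  move=> cy; have -> : c = (c `^ (2 / alpha - 1)^-1) `^ (2 / alpha - 1).
    by rewrite -powRrM mulVf ?gt_eqF// powRr1.
  by apply: (ge0_ler_powR (ltW b0)); rewrite ?nnegrE ?powR_ge0 ?(ltW y0).
have pE := tail _ x0u; rewrite uy in pE.
apply/andP; split; last exact/probability_le1/measurable_Mmax_eq_Umax.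
have := probability_Mmax_eq_Umax_ge indX idX n (sqr_ge0 (u / a))
  (expR_ge0 (- (D1 * u `^ alpha))) (expR_ge0 (- (s / 2 * u ^+ 2)))
  (fun I uI I2 => block u I u0 uI I2).
apply: le_trans; rewrite lee_fin lerD2l lerN2 uy D1E.
exact: error_le.
Unshelve. all: by end_near. Qed.
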